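(* Let $\mathcal{F}$ be a finite field, and consider random linear network coding over $\mathcal{F}$ with information rate $2$ for the butterfly network $G$ (all local encoding coefficients independent and uniformly distributed on $\mathcal{F}$). Then: (i) for $i=1,2$, the failure probability of the sink node $t_i$ is $$P_e(t_i)=1-\frac{(|\mathcal{F}|+1)(|\mathcal{F}|-1)^6}{|\mathcal{F}|^7};$$ (ii) the failure probability of the butterfly network $G$ is $$P_e=1-\frac{(|\mathcal{F}|+1)(|\mathcal{F}|-1)^{10}}{|\mathcal{F}|^{11}};$$ (iii) the average failure probability is $$P_{av}=1-\frac{(|\mathcal{F}|+1)(|\mathcal{F}|-1)^6}{|\mathcal{F}|^7}.$$
   Context: Butterfly network. $G=(V,E)$ is the directed acyclic graph with nodes $s$ (source), $s_1,s_2,i,j$ (internal nodes), $t_1,t_2$ (sinks, $T=\{t_1,t_2\}$) and channels (edges) $e_1=(s,s_1)$, $e_2=(s,s_2)$, $e_3=(s_1,t_1)$, $e_4=(s_1,i)$, $e_5=(s_2,i)$, $e_6=(s_2,t_2)$, $e_7=(i,j)$, $e_8=(j,t_1)$, $e_9=(j,t_2)$. Each channel is error-free with unit capacity. In addition, the source $s$ has two imaginary incoming channels $d_1,d_2$ carrying the two source messages. Random linear network coding with information rate $2$. The local encoding coefficients are the twelve random variables $k_{d_1,1},k_{d_2,1},k_{d_1,2},k_{d_2,2},k_{1,3},k_{1,4},k_{2,5},k_{2,6},k_{4,7},k_{5,7},k_{7,8},k_{7,9}$, which are independent and uniformly distributed on the finite field $\mathcal{F}$. The global encoding kernels are the following column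 vectors in $\mathcal{F}^2$: $f_{d_1}=\binom{1}{0}$, $f_{d_2}=\binom{0}{1}$, and $$f_1=k_{d_1,1}f_{d_1}+k_{d_2,1}f_{d_2},\quad f_2=k_{d_1,2}f_{d_1}+k_{d_2,2}f_{d_2},$$ $$f_3=k_{1,3}f_1,\quad f_4=k_{1,4}f_1,\quad f_5=k_{2,5}f_2,\quad f_6=k_{2,6}f_2,$$ $$f_7=k_{4,7}f_4+k_{5,7}f_5,\quad f_8=k_{7,8}f_7,\quad f_9=k_{7,9}f_7.$$ The decoding matrices of the sinks are the $2\times 2$ matrices $F_{t_1}=(f_3\ f_8)$ and $F_{t_2}=(f_6\ f_9)$. Failure probabilities. $P_e(t_i)=\Pr(\mathrm{Rank}(F_{t_i})<2)$ for $i=1,2$; $P_e=\Pr(\exists\, t\in T \text{ such that } \mathrm{Rank}(F_t)<2)$; $P_{av}=\frac{1}{|T|}\sum_{t\in T}P_e(t)=\frac{P_e(t_1)+P_e(t_2)}{2}$. *)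

(* Defs.v *)
From HB Require Import structures.
From mathcomp Require Import all_boot all_order all_algebra.
From mathcomp Require Import all_classical all_reals all_analysis.

Set Implicit Arguments.
Unset Strict Implicit.
Unset Printing Implicit Defensive.

Import Order.TTheory GRing.Theory Num.Theory.

Local Open Scope classical_set_scope.
Local Open Scope ring_scope.

Inductive sink := t1 | t2.

(* [src], [ni], [nj] are the nodes s, i, j. *)
Inductive node := src | s1 | s2 | ni | nj | Sink of sink.

(* [d1] and [d2] are the imaginary incoming channels of the source. *)
Inductive channel := d1 | d2 | e1 | e2 | e3 | e4 | e5 | e6 | e7 | e8 | e9.

Definition bool_of_sink (t : sink) : bool := if t is t1 then true else false.
Definition sink_of_bool (b : bool) : sink := if b then t1 else t2.
Lemma bool_of_sinkK : cancel bool_of_sink sink_of_bool.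
Proof. by case. Qed.
HB.instance Definition _ := Countable.copy sink (can_type bool_of_sinkK).
Lemma sink_enumP : Finite.axiom [:: t1; t2].
Proof. by case. Qed.
HB.instance Definition _ := fintype.isFinite.Build sink sink_enumP.

Definition node_enum := [:: src; s1; s2; ni; nj; Sink t1; Sink t2].
Definition node_code (v : node) : nat :=
  match v with
  | src => 0 | s1 => 1 | s2 => 2 | ni => 3 | nj => 4
  | Sink t1 => 5 | Sink t2 => 6
  end%N.
Lemma node_codeK : pcancel node_code (onth node_enum).
Proof. by do 2?case. Qed.
HB.instance Definition _ := Countable.copy node (pcan_type node_codeK).
Lemma node_enumP : Finite.axiom node_enum.
Proof. by do 2?case. Qed.
HB.instance Definition _ := fintype.isFinite.Build node node_enumP.

Definition channel_enum := [:: d1; d2; e1; e2; e3; e4; e5; e6; e7; e8; e9].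
Definition channel_code (e : channel) : nat :=
  match e with
  | d1 => 0 | d2 => 1 | e1 => 2 | e2 => 3 | e3 => 4 | e4 => 5
  | e5 => 6 | e6 => 7 | e7 => 8 | e8 => 9 | e9 => 10
  end%N.
Lemma channel_codeK : pcancel channel_code (onth channel_enum).
Proof. by case. Qed.
HB.instance Definition _ := Countable.copy channel (pcan_type channel_codeK).
Lemma channel_enumP : Finite.axiom channel_enum.
Proof. by case. Qed.
HB.instance Definition _ := fintype.isFinite.Build channel channel_enumP.

(* [None] means that the channel is imaginary: it originates at no node. *)
Definition tail (e : channel) : option node :=
  match e with
  | d1 | d2 => None
  | e1 | e2 => Some src
  | e3 | e4 => Some s1
  | e5 | e6 => Some s2
  | e7 => Some ni
  | e8 | e9 => Some nj
  end.

Definition head (e : channel) : node :=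
  match e with
  | d1 | d2 => src
  | e1 => s1
  | e2 => s2
  | e4 | e5 => ni
  | e7 => nj
  | e3 | e8 => Sink t1
  | e6 | e9 => Sink t2
  end.

Definition adjacent (d e : channel) : bool := tail e == Some (head d).

(* The index set of the local encoding coefficients. *)
Definition adjacent_pairs : {set channel * channel} :=
  [set p | adjacent p.1 p.2]%SET.

Lemma adjacent_pairsE : adjacent_pairs =i
  [:: (d1, e1); (d2, e1); (d1, e2); (d2, e2); (e1, e3); (e1, e4);
      (e2, e5); (e2, e6); (e4, e7); (e5, e7); (e7, e8); (e7, e9)].
Proof. by case=> d e; rewrite inE; case: d; case: e. Qed.

Section Coding.
Variables (F : finFieldType) (k : channel * channel -> F).

Definition global_kernel (e : channel) : 'cV[F]_2 :=
  let fd1 := delta_mx 0 0 in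
  let fd2 := delta_mx 1 0 in
  let f1 := k (d1, e1) *: fd1 + k (d2, e1) *: fd2 in
  let f2 := k (d1, e2) *: fd1 + k (d2, e2) *: fd2 in
  let f3 := k (e1, e3) *: f1 in
  let f4 := k (e1, e4) *: f1 in
  let f5 := k (e2, e5) *: f2 in
  let f6 := k (e2, e6) *: f2 in
  let f7 := k (e4, e7) *: f4 + k (e5, e7) *: f5 in
  let f8 := k (e7, e8) *: f7 in
  let f9 := k (e7, e9) *: f7 in
  match e with
  | d1 => fd1 | d2 => fd2
  | e1 => f1 | e2 => f2 | e3 => f3 | e4 => f4 | e5 => f5
  | e6 => f6 | e7 => f7 | e8 => f8 | e9 => f9
  end.

Lemma global_kernelE (e : channel) : tail e != None ->
  global_kernel e = \sum_(d | adjacent d e) k (d, e) *: global_kernel d.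
Proof.
have -> : index_enum channel = channel_enum.
  by rewrite [index_enum _]unlock Finite.enum.unlock.
rewrite big_mkcond /channel_enum !big_cons big_nil.
by case: e => // _; rewrite /= ?(add0r, addr0).
Qed.

Definition decoding_mx (t : sink) : 'M[F]_2 :=
  match t with
  | t1 => row_mx (global_kernel e3) (global_kernel e8)
  | t2 => row_mx (global_kernel e6) (global_kernel e9)
  end.

End Coding.

Section Probability.
Variables (d : measure_display) (Omega : measurableType d) (R : realType).
Variables (P : probability Omega R) (F : finFieldType).

(* Measurability with respect to the discrete sigma-algebra on F. *)
Definition random_element (X : Omega -> F) : Prop :=
  forall A : set F, measurable (X @^-1` A).

Definition uniformly_distributed (X : Omega -> F) : Prop :=
  forall a : F, P (X @^-1` [set a]) = ((#|F|%:R : R)^-1)%:E.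

Definition mutually_independent (I : finType) (D : {set I})
    (X : I -> Omega -> F) : Prop :=
  forall (J : {set I}) (A : I -> set F), J \subset D ->
    P (\bigcap_(i in [set` J]) X i @^-1` A i) =
    (\big[*%E/1%E]_(i in J) P (X i @^-1` A i))%E.

(* Only the components of [k] indexed by [adjacent_pairs] are constrained;
   the other ones are never used by the code. *)
Definition random_coding (k : channel * channel -> Omega -> F) : Prop :=
  [/\ forall p, p \in adjacent_pairs -> random_element (k p),
      forall p, p \in adjacent_pairs -> uniformly_distributed (k p) &
      mutually_independent adjacent_pairs k].

Variable k : channel * channel -> Omega -> F.

Definition sink_failure (t : sink) : set Omega :=
  [set w | (\rank (decoding_mx (k^~ w) t) < 2)%N].

Definition Pe_sink (t : sink) : \bar R := P (sink_failure t).

Definition Pe : \bar R := P [set w | exists t, sink_failure t w].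

Definition Pav : \bar R :=
  (((#|{: sink}|%:R : R)^-1)%:E * \sum_(t : sink) Pe_sink t)%E.

End Probability.

(* Main.v *)
(* At each sink the determinant of the decoding matrix is, up to sign, the
   determinant of the 2x2 matrix (f_1 f_2) of source coefficients times four
   further coefficients, and the two groups of four are disjoint. Hence a
   decoding event says that (f_1 f_2) is invertible and that n other independent
   coefficients are nonzero (n = 4 for one sink, n = 8 for both). Conditioning
   on the value of (f_1 f_2), uniform on the 2x2 matrices, the probability is
   |GL_2(F)| / q^4 * (1 - 1/q)^n. *)
Require Import Defs.
From mathcomp Require Import all_boot all_order all_algebra ring.
From mathcomp Require Import all_classical all_reals all_analysis.

Set Implicit Arguments.
Unset Strict Implicit.
Unset Printing Implicit Defensive.

Import GRing.Theory Num.Theory.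

Local Open Scope classical_set_scope.
Local Open Scope ring_scope.

Definition source_pairs : seq (channel * channel) :=
  [:: (d1, e1); (d2, e1); (d1, e2); (d2, e2)].

(* The coefficients on the two paths carrying to [t] its direct symbol and, via
   e7, the symbol of the other source branch. *)
Definition critical_pairs (t : sink) : seq (channel * channel) :=
  match t with
  | t1 => [:: (e1, e3); (e2, e5); (e5, e7); (e7, e8)]
  | t2 => [:: (e2, e6); (e1, e4); (e4, e7); (e7, e9)]
  end.

(** The columns are the kernels f_1 and f_2. *)
Definition source_mx (F : finFieldType) (k : channel * channel -> F) : 'M[F]_2 :=
  \matrix_(i, j) k (if i == 0 then d1 else d2, if j == 0 then e1 else e2).

Definition source_entry (F : finFieldType) (M : 'M[F]_2)
    (p : channel * channel) : F :=
  M (if p.1 == d1 then 0 else 1) (if p.2 == e1 then 0 else 1).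

(** Splits an event about the whole matrix into events about single coefficients, the form that
    [mutually_independent] can handle. *)
Lemma source_mx_eqP (F : finFieldType) (k : channel * channel -> F) M :
  source_mx k = M <-> (forall p, p \in source_pairs -> k p = source_entry M p).
Proof.
split=> [<- p|kM].
  by rewrite !inE => /or4P[] /eqP->; rewrite /source_entry mxE.
apply/matrixP => i j; rewrite mxE kM; first last.
  by case: ifP; case: ifP; rewrite !inE.
by rewrite /source_entry /=; congr (M _ _);
  [case: i => [[|[|]]]|case: j => [[|[|]]]] => // ?; apply: val_inj.
Qed.

Lemma det_mx22 (R : comPzRingType) (M : 'M[R]_2) :
  \det M = M 0 0 * M 1 1 - M 0 1 * M 1 0.
Proof.
rewrite (expand_det_row _ 0) !big_ord_recl big_ord0 /cofactor !det_mx11 !mxE.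
rewrite /= expr0 mul1r addr0 expr1 mulN1r mulrN.
by congr (M _ _ * M _ _ - M _ _ * M _ _); apply: val_inj.
Qed.

(** At [t1], f_3 is a multiple of f_1, so only the f_2 component of f_8 contributes to the
    determinant. At [t2] the roles of f_1 and f_2 are exchanged, which costs a sign. *)
Lemma decoding_mx_det_neq0 (F : finFieldType) (k : channel * channel -> F) t :
  (\det (decoding_mx k t) != 0) =
  (\det (source_mx k) != 0) && all (fun p => k p != 0) (critical_pairs t).
Proof.
have row_mx0 (u v : 'cV[F]_2) i : row_mx u v i (0 : 'I_2) = u i 0.
  by rewrite -(row_mxEl u v); congr (row_mx u v _ _); apply: val_inj.
have row_mx1 (u v : 'cV[F]_2) i : row_mx u v i (1 : 'I_2) = v i 0.
  by rewrite -(row_mxEr u v); congr (row_mx u v _ _); apply: val_inj.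
have -> : \det (decoding_mx k t) = (if t is t1 then 1 else -1) *
    \det (source_mx k) * \prod_(p <- critical_pairs t) k p.
  rewrite !det_mx22 [in RHS]/source_mx.
  case: t => /=; rewrite !(row_mx0, row_mx1) !mxE /= !big_cons big_nil; ring.
rewrite !mulf_eq0 !negb_or prodf_seq_neq0; congr (_ && _).
by case: t; rewrite ?oppr_eq0 oner_eq0.
Qed.

Lemma mxrank_lt_det (F : fieldType) n (A : 'M[F]_n) :
  (\rank A < n)%N = (\det A == 0).
Proof.
by rewrite ltn_neqAle rank_leq_row andbT [_ == n]row_free_unit unitmxE unitfE
  negbK.
Qed.

Lemma card_det_neq0_mx22 (F : finFieldType) :
  #|[pred M : 'M[F]_2 | \det M != 0]| = (#|F| * #|F|.-1 ^ 2 * #|F|.+1)%N.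
Proof.
rewrite -card_GL_2 cardsT card_sub; apply: eq_card => M.
by rewrite !inE -unitfE -unitmxE.
Qed.

Section Success.
Variables (d : measure_display) (Omega : measurableType d) (R : realType).
Variables (P : probability Omega R) (F : finFieldType).
Variable k : channel * channel -> Omega -> F.
Hypothesis rk : random_coding P k.

Let q : R := #|F|%:R.

(** The list [s] is left free so that one computation covers both a single sink and the two sinks
    jointly. *)
Definition success (s : seq (channel * channel)) : set Omega :=
  [set w | \det (source_mx (k^~ w)) != 0 /\ all (fun p => k p w != 0) s].

Lemma prob_coef_neq0 p : p \in adjacent_pairs ->
  P (k p @^-1` ~` [set 0]) = (1 - q^-1)%:E.
Proof.
case: rk => mk uk _ pA.
by rewrite -preimage_setC probability_setC ?uk//; exact: mk.
Qed.

Variable s : seq (channel * channel).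
Hypothesis uniq_s : uniq (source_pairs ++ s).
Hypothesis adj_s : {subset source_pairs ++ s <= adjacent_pairs}.

Let J : {set channel * channel} := [set p in source_pairs ++ s]%SET.

Let value (M : 'M[F]_2) p : set F :=
  if p \in source_pairs then [set source_entry M p] else ~` [set 0].

(** Invertibility of (f_1 f_2) does not constrain each coefficient separately, but fixing the value
    [M] does. *)
Let cylinder M : set Omega :=
  \bigcap_(p in [set` J]) k p @^-1` value M p.

Let cylinderP M w : cylinder M w <->
  source_mx (k^~ w) = M /\ all (fun p => k p w != 0) s.
Proof.
split=> [kw|[/source_mx_eqP kM /allP k0] p /=].
  split.
    apply/source_mx_eqP => p pS; have := kw p.
    by rewrite /value /= inE mem_cat pS; exact.
  apply/allP => p ps; have := kw p; rewrite /value /= inE mem_cat ps orbT.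
  case: ifP => [pS|_ /(_ isT) /eqP//].
  (* A pair of [s] cannot be a source pair, so [value] imposes nonvanishing on it rather than a
     fixed entry. *)
  move: uniq_s; rewrite cat_uniq => /and3P[_ /hasPn/(_ p ps)].
  by rewrite /= pS.
rewrite inE mem_cat /value.
by case: ifP => [pS _|_ /= ps]; [exact: kM | exact/eqP/k0].
Qed.

Let measurable_cylinder M : measurable (cylinder M).
Proof.
case: rk => mk _ _; apply: fin_bigcap_measurable => // p /=.
by rewrite inE => /adj_s/mk; exact.
Qed.

Let prob_cylinder M : P (cylinder M) = (q^-1 ^+ 4 * (1 - q^-1) ^+ size s)%:E.
Proof.
case: (rk) => _ uk ->; last by apply/fintype.subsetP => p; rewrite inE => /adj_s.
have prod_const (r : seq (channel * channel)) c :
    {in r, forall p, P (k p @^-1` value M p) = c%:E} ->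
    (\prod_(p <- r) P (k p @^-1` value M p) = (c ^+ size r)%:E)%E.
  move=> rc; rewrite (eq_big_seq (fun=> c%:E) rc) prodEFin big_const_seq.
  by rewrite count_predT iter_mulr_1.
(* The product over the set [J] becomes a product over a duplicate-free list, which splits into four
   factors 1/q and [size s] factors 1 - 1/q. *)
rewrite (eq_bigl [in source_pairs ++ s]); last by move=> p; rewrite inE.
rewrite -big_uniq//= [LHS](big_cat _ source_pairs) EFinM.
congr (_ * _)%E; apply: prod_const => p pS.
  by rewrite /value pS uk// adj_s// mem_cat pS.
rewrite /value ifN ?prob_coef_neq0 ?adj_s ?mem_cat ?pS ?orbT//.
by move: uniq_s; rewrite cat_uniq => /and3P[_ /hasPn/(_ p pS)].
Qed.

Let success_bigcup :
  success s = \bigcup_(M in [set M : 'M[F]_2 | \det M != 0]) cylinder M.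
Proof.
apply/seteqP; split=> w.
  by move=> [K0 k0]; exists (source_mx (k^~ w)) => //; apply/cylinderP.
by move=> [M /= M0 /cylinderP[K k0]]; split => //; rewrite K.
Qed.

Lemma measurable_success : measurable (success s).
Proof. by rewrite success_bigcup; exact: fin_bigcup_measurable. Qed.

(** The cylinders over invertible [M] are disjoint and equally likely, and there are q (q - 1)^2 (q
    + 1) of them; one factor q cancels against q^4. *)
Lemma prob_success : P (success s) =
  ((q + 1) * (q - 1) ^+ (size s + 2) / q ^+ (size s + 3))%:E.
Proof.
rewrite success_bigcup measure_fin_bigcup; first last.
- by move=> M _.
- by move=> M N _ _ [w [/cylinderP[<- _] /cylinderP[<- _]]].
- exact: finite_finset.
transitivity (\sum_(M : 'M[F]_2 | \det M != 0%R) P (cylinder M))%E.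
  apply/esym/(bigfs _ (P := fun M : 'M[F]_2 => \det M != 0)).
    exact: index_enum_uniq.
  by move=> M _; rewrite mem_index_enum.
rewrite (eq_bigr _ (fun M _ => prob_cylinder M)).
rewrite sumEFin sumr_const -[_ *+ _]mulr_natl card_det_neq0_mx22.
have q0 : q != 0 by rewrite pnatr_eq0 -lt0n; apply/card_gt0P; exists 0.
rewrite 2!natrM natrX -natr1 -subn1 natrB -/q;
  last exact: ltnW (card_finNzRing_gt1 F).
have -> : 1 - q^-1 = (q - 1) / q by field.
rewrite expr_div_n !exprD; congr (_%:E); field.
by rewrite q0 expf_neq0.
Qed.

End Success.

Theorem theorem1 (d : measure_display) (Omega : measurableType d)
    (R : realType) (P : probability Omega R) (F : finFieldType)
    (k : channel * channel -> Omega -> F) :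
  random_coding P k ->
  let q : R := #|F|%:R in
  [/\ forall t : sink,
        Pe_sink P k t = (1 - (q + 1) * (q - 1) ^+ 6 / q ^+ 7)%:E,
      Pe P k = (1 - (q + 1) * (q - 1) ^+ 10 / q ^+ 11)%:E &
      Pav P k = (1 - (q + 1) * (q - 1) ^+ 6 / q ^+ 7)%:E].
Proof.
move=> rk q.
have failureE t : sink_failure k t = ~` success k (critical_pairs t).
  apply/seteqP; split=> w; rewrite /sink_failure /success /= mxrank_lt_det.
    by move=> D0 /andP; rewrite -decoding_mx_det_neq0 D0.
  by move=> Nw; apply/negPn/negP; rewrite decoding_mx_det_neq0 => /andP.
have probC s : uniq (source_pairs ++ s) ->
    {subset source_pairs ++ s <= adjacent_pairs} ->
    P (~` success k s) =
    (1 - (q + 1) * (q - 1) ^+ (size s + 2) / q ^+ (size s + 3))%:E.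
  move=> us As.
  rewrite probability_setC; last exact: (measurable_success rk).
  by rewrite (prob_success rk us As).
have adjP s : all [in adjacent_pairs] s -> {subset s <= adjacent_pairs}.
  by move=> /allP.
have sinkE t : Pe_sink P k t = (1 - (q + 1) * (q - 1) ^+ 6 / q ^+ 7)%:E.
  rewrite /Pe_sink failureE probC; first by case: t.
    by case: t.
  by apply: adjP; case: t; rewrite /= !inE.
split=> //.
  (* The two critical lists are disjoint, so their concatenation is an admissible list of length 8,
     whence the exponents 10 and 11. *)
  rewrite /Pe (_ : [set _ | _] =
    ~` success k (critical_pairs t1 ++ critical_pairs t2)).
    by rewrite probC//; apply: adjP; rewrite /= !inE.
  apply/seteqP; split=> w.
    move=> [t]; rewrite failureE => Nt [K0]; rewrite all_cat => /andP[K1 K2].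
    by apply: Nt; split=> //; case: t.
  move=> Nw; apply: contrapT => noF; apply: Nw.
  have succ t : success k (critical_pairs t) w.
    by apply: contrapT => Nt; apply: noF; exists t; rewrite failureE.
  have [[K0 K1] [_ K2]] := (succ t1, succ t2).
  by split; rewrite // all_cat K1 K2.
rewrite /Pav (eq_bigr (fun=> (1 - (q + 1) * (q - 1) ^+ 6 / q ^+ 7)%:E)) //.
rewrite sumEFin sumr_const -EFinM -[X in _ * X]mulr_natl mulKf//.
by rewrite pnatr_eq0 -lt0n; apply/card_gt0P; exists t1.
Qed.
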